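(* Let $n\ge 1$, let $U_n$ be the weight matrix of the $U$-type network of order $n$ in which a rise edge from $(k,y)$ to $(k+1,y+1)$ (with $y\neq n$) has weight $t_{y-k,y+1}$ and every horizontal edge has weight $1$, and let $U^{-1}$ denote the weight matrix of the $U$-type network of order $n$ in which a rise edge from $(k,y-1)$ to $(k+1,y)$ (with $y\ne 0$) has weight $-t_{k,y}$ and every horizontal edge has weight $1$. Then $U_nU^{-1}=I_{n+1}$, the $(n+1)\times(n+1)$ identity matrix.
   Context: Let $t_{a,b}$ be real scalars for integers $0\le a<b$ (the same family for both matrices). Rows and columns of $(n+1)\times(n+1)$ matrices are indexed by $0,\dots,n$. Paths of the $U$-type network of order $n$ from source $i$ to sink $j$: $\mathcal{P}^{U_n}_{i,j}$ is the set of sequences of points $(k,y_k)$, $k=0,\dots,n$, with $y_k\in\{0,\dots,n\}$, $y_0=i$, $y_n=j$, $y_{k+1}\in\{y_k,y_k+1\}$ for $k<n$, and such that $y_{k+1}=y_k+1$ implies $y_k\ge k$. The weight $\omega(p)$ of a path is the product of the weights of its edges (steps), and the weight matrix is the $(n+1)\times(n+1)$ matrix whose $(i,j)$ entry is $\sum_{p\in\mathcal{P}^{U_n}_{i,j}}\omega(p)$. The symbol $U^{-1}$ is a priori only the name of the second weight matrix. *)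

(* Defs.v *)
From mathcomp Require Import all_boot all_order all_algebra.
From mathcomp Require Import reals.
Set Implicit Arguments.
Unset Strict Implicit.
Unset Printing Implicit Defensive.

Import GRing.Theory.
Local Open Scope ring_scope.

(* A lattice path (0, y_0), ..., (n, y_n) with y_k in {0, ..., n} is encoded by
   the finite function p with p k = y_k. Its k-th step (k < n) goes from
   (k, step_src p k) to (k + 1, step_tgt p k). *)
Definition step_src n (p : {ffun 'I_n.+1 -> 'I_n.+1}) (k : 'I_n) : nat :=
  p (widen_ord (leqnSn n) k).

Definition step_tgt n (p : {ffun 'I_n.+1 -> 'I_n.+1}) (k : 'I_n) : nat :=
  p (lift ord0 k).

Definition Uedge (k y y' : nat) : bool :=
  ((y' == y) || (y' == y.+1)) && ((y' == y.+1) ==> (k <= y)%N).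

Definition Upaths n (i j : 'I_n.+1) : {set {ffun 'I_n.+1 -> 'I_n.+1}} :=
  [set p : {ffun 'I_n.+1 -> 'I_n.+1} |
     [&& p ord0 == i, p ord_max == j &
         [forall k : 'I_n, Uedge k (step_src p k) (step_tgt p k)]]].

(* w k y y' is the weight of the edge from (k, y) to (k + 1, y'). *)
Definition path_weight (R : realType) (w : nat -> nat -> nat -> R) n
    (p : {ffun 'I_n.+1 -> 'I_n.+1}) : R :=
  \prod_(k < n) w k (step_src p k) (step_tgt p k).

Definition weight_mx (R : realType) (w : nat -> nat -> nat -> R) n :
    'M[R]_n.+1 :=
  \matrix_(i, j) \sum_(p in Upaths i j) path_weight w p.

(* Only the values t a b with a < b matter: on a rise edge k <= y and
   y' = y + 1, so the subtraction y - k is exact and both y - k < y + 1 and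
   k < y' hold. *)
Definition U_weight (R : realType) (t : nat -> nat -> R) (k y y' : nat) : R :=
  if y' == y then 1 else t (y - k)%N y.+1.

Definition Uinv_weight (R : realType) (t : nat -> nat -> R) (k y y' : nat) : R :=
  if y' == y then 1 else - t k y'.

Definition U_mx (R : realType) (t : nat -> nat -> R) n : 'M[R]_n.+1 :=
  weight_mx (U_weight t) n.

(* The weight matrix that is named U^{-1}; it is not defined as an inverse. *)
Definition Uinv_mx (R : realType) (t : nat -> nat -> R) n : 'M[R]_n.+1 :=
  weight_mx (Uinv_weight t) n.

(* Main.v *)
Require Import Defs.
From mathcomp Require Import all_boot all_order all_algebra.
From mathcomp Require Import reals.

(** A sum over paths is an entry of an ordered product of transfer matrices,
    one for each column of edges ([sum_walks]).  Rise edges raise the height by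
    one, so each transfer matrix is unipotent upper bidiagonal, [bidiag c] with
    [c y] the weight of the rise from height [y].  Products of these are
    governed by one rule ([bidiag_mul]): when a nonzero entry at [(y, y+1)]
    of the left factor is never followed by one at [(y+1, y+2)] of the right
    factor, superdiagonals add up.

    Write [x_y(s)] for the identity with [s] added at position [(y, y+1)].  Then
    the first weight matrix is a word in the letters [x_(b-1)(t_(a,b))],
    [a < b], sorted by increasing [b - 1 - a], whereas the inverse of the second one is a
    word in the same letters, sorted by decreasing [a].  The two words differ
    only by exchanges of letters [x_y], [x_z] with [|y - z| >= 2], which
    commute.

    The exchanges are carried out one value of [a] at a time.  Let [U_col t n a k]
    be the [k]-th transfer matrix of the first network in which only the
    letters [t_(a',b)] with [a <= a'] are kept.  Its letter [t_(a,k+a+1)] splits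
    off on the right and commutes with all later columns, so all the letters of
    first index [a] can be collected at the right end of the product, where
    they cancel against the [a]-th transfer matrix of the second network
    ([U_cols_peel]).  After [n] such steps every column is trivial. *)

Set Implicit Arguments.
Unset Strict Implicit.
Unset Printing Implicit Defensive.

Import GRing.Theory.
Local Open Scope ring_scope.

(** * Sums over walks as products of matrices *)

Definition ffun_cons (T : Type) m (q : T * {ffun 'I_m -> T}) :
    {ffun 'I_m.+1 -> T} :=
  [ffun k => if unlift ord0 k is Some k' then q.2 k' else q.1].

Lemma ffun_cons0 (T : Type) m (q : T * {ffun 'I_m -> T}) :
  ffun_cons q ord0 = q.1.
Proof. by rewrite ffunE unlift_none. Qed.

Lemma ffun_consS (T : Type) m (q : T * {ffun 'I_m -> T}) (k : 'I_m) :
  ffun_cons q (lift ord0 k) = q.2 k.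
Proof. by rewrite ffunE liftK. Qed.

Lemma ffun_cons_bij (T : Type) m : bijective (@ffun_cons T m).
Proof.
exists (fun p : {ffun 'I_m.+1 -> T} =>
  (p ord0, [ffun k : 'I_m => p (lift ord0 k)])) => [[x f] | p].
  rewrite ffun_cons0; congr (_, _).
  by apply/ffunP=> k; rewrite ffunE ffun_consS.
apply/ffunP=> k; case: (unliftP ord0 k) => [k' -> | ->].
  by rewrite ffun_consS ffunE.
by rewrite ffun_cons0.
Qed.

(** The number [m] of steps is independent of the size of the matrices, which
    makes induction on the first step possible. *)
Lemma sum_walks (R : nzRingType) n m (T : nat -> 'M[R]_n.+1) (i j : 'I_n.+1) :
  \sum_(p : {ffun 'I_m.+1 -> 'I_n.+1} | (p ord0 == i) && (p ord_max == j))
    \prod_(k < m) T k (p (widen_ord (leqnSn m) k)) (p (lift ord0 k))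
  = (\prod_(k < m) T k) i j.
Proof.
elim: m T i => [|m IHm] T i;
    rewrite (reindex _ (onW_bij _ (ffun_cons_bij _ _))) /=.
  rewrite big_ord0 mxE.
  under eq_bigr do rewrite big_ord0.
  (* A walk without steps is the choice of a single vertex. *)
  have end0 (q : 'I_n.+1 * {ffun 'I_0 -> 'I_n.+1}) :
    ffun_cons q ord_max = q.1.
    by rewrite -(ffun_cons0 q); congr (ffun_cons _ _); apply: val_inj.
  under eq_bigl do rewrite ffun_cons0 end0 -[_ && _]andbT.
  rewrite -(pair_big_dep (fun x => (x == i) && (x == j)) (fun _ _ => true)
    (fun _ _ => 1)) /=.
  rewrite big_mkcondr big_pred1_eq /= sumr_const.
  by rewrite card_ffun !card_ord expn0; case: (i == j).
rewrite big_ord_recl mxE.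
under [RHS]eq_bigr => y _.
  rewrite -(IHm (fun k => T k.+1) y) big_distrr /=.
  over.
have end_cons (q : 'I_n.+1 * {ffun 'I_m.+1 -> 'I_n.+1}) :
  ffun_cons q ord_max = q.2 ord_max.
  by rewrite -(ffun_consS q); congr (ffun_cons _ _); apply: val_inj.
under eq_bigl do rewrite ffun_cons0 end_cons.
rewrite -(pair_big_dep (fun x => x == i)
  (fun _ (f : {ffun 'I_m.+1 -> 'I_n.+1}) => f ord_max == j)
  (fun x (f : {ffun 'I_m.+1 -> 'I_n.+1}) =>
    \prod_(k < m.+1) T k (ffun_cons (x, f) (widen_ord (leqnSn m.+1) k))
                         (ffun_cons (x, f) (lift ord0 k)))) /=.
rewrite big_pred1_eq.
(* Walks are sorted by the vertex reached after the first step, which is the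
   summation index of the matrix product. *)
rewrite (partition_big (fun f : {ffun 'I_m.+1 -> 'I_n.+1} => f ord0) predT) //=.
apply: eq_bigr => y _.
apply: eq_big => [f | f /andP[_ /eqP f0]]; first by rewrite andbC.
rewrite big_ord_recl ffun_consS f0.
congr (T _ _ _ * _).
  by rewrite -[RHS](ffun_cons0 (i, f)); congr (ffun_cons _ _); apply: val_inj.
apply: eq_bigr => k _; rewrite ffun_consS.
congr (T _ _ _).
rewrite -(ffun_consS (i, f)); congr (ffun_cons _ _).
exact: val_inj.
Qed.

(** * Unipotent upper bidiagonal matrices *)

Section Bidiagonal.

Variables (R : nzRingType) (n : nat).
Implicit Types c d e : nat -> R.

Definition superdiag c : 'M[R]_n.+1 :=
  \matrix_(i, j) (c i *+ (j == i.+1 :> nat)).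

Definition bidiag c : 'M[R]_n.+1 := 1 + superdiag c.

Lemma eq_bidiag c d : (forall y, (y < n)%N -> c y = d y) -> bidiag c = bidiag d.
Proof.
move=> cd; congr (_ + _); apply/matrixP=> i j; rewrite !mxE.
by case: eqP => // ji; rewrite cd // -ltnS -ji.
Qed.

Lemma bidiag0 c : (forall y, (y < n)%N -> c y = 0) -> bidiag c = 1.
Proof.
move=> c0; rewrite (eq_bidiag (d := fun=> 0)) // -[RHS]addr0; congr (_ + _).
by apply/matrixP=> i j; rewrite !mxE mul0rn.
Qed.

(** The hypothesis kills the second superdiagonal, the only place where the
    product can fail to be bidiagonal. *)
Lemma bidiag_mul c d e :
    (forall y, c y * d y.+1 = 0) ->
    (forall y, (y < n)%N -> c y + d y = e y) ->
  bidiag c * bidiag d = bidiag e.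
Proof.
move=> cd0 cde; rewrite -(eq_bidiag cde) /bidiag.
have SS0: superdiag c * superdiag d = 0.
  apply/matrixP=> i j; rewrite !mxE big1 // => k _; rewrite !mxE.
  by case: eqP => [-> | _]; rewrite ?mul0r // mulrnAr cd0 mul0rn.
rewrite mulrDl mul1r mulrDr mulr1 SS0 addr0 -addrA; congr (_ + _).
by rewrite addrC; apply/matrixP=> i j; rewrite !mxE mulrnDl.
Qed.

End Bidiagonal.

Lemma prod_mul_commute (R : pzRingType) (X Y : nat -> R) m :
    (forall k l, (k < l)%N -> GRing.comm (X l) (Y k)) ->
  \prod_(k < m) (X k * Y k) = \prod_(k < m) X k * \prod_(k < m) Y k.
Proof.
move=> XY; elim: m => [|m IHm]; first by rewrite !big_ord0 mulr1.
rewrite !big_ord_recr /= IHm !mulrA; congr (_ * _); rewrite -!mulrA.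
congr (_ * _); apply/esym/commr_prod => k _.
exact: XY.
Qed.

(** * Transfer matrices of the two networks *)

Section Columns.

Variables (R : nzRingType) (t : nat -> nat -> R) (n : nat).

Definition U_col a k : 'M[R]_n.+1 :=
  bidiag n (fun y => if (k + a <= y)%N then t (y - k)%N y.+1 else 0).

Definition Uinv_col a : 'M[R]_n.+1 :=
  bidiag n (fun y => if (a <= y)%N then - t a y.+1 else 0).

(** The letter [x_m(t_(a,m+1))]. *)
Definition letter a m : 'M[R]_n.+1 :=
  bidiag n (fun y => if y == m then t a y.+1 else 0).

(** The split-off letter sits at the lowest position of the column, where it
    cannot be continued from the left factor. *)
Lemma U_col_split a k : U_col a k = U_col a.+1 k * letter a (k + a)%N.
Proof.
apply/esym/bidiag_mul => y.
  case: eqP => [yka | _]; last by rewrite mulr0.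
  by rewrite addnS -yka ltnNge leqnSn mul0r.
move=> _; rewrite addnS.
case: ltngtP => [kay | yka | <-]; rewrite ?addr0 ?add0r //.
by rewrite addKn.
Qed.

(** All positions of the later column exceed that of the letter by at least 2,
    so that in either order the product just adds superdiagonals. *)
Lemma U_col_letter_comm a k l :
  (k < l)%N -> GRing.comm (U_col a.+1 l) (letter a (k + a)%N).
Proof.
move=> kl; rewrite /GRing.comm.
pose c y := (if (l + a.+1 <= y)%N then t (y - l)%N y.+1 else 0)
            + (if y == (k + a)%N then t a y.+1 else 0).
transitivity (bidiag n c); [|apply/esym]; apply: bidiag_mul => y.
- case: eqP => [yka | _]; last by rewrite mulr0.
  rewrite leqNgt (_ : (y < l + a.+1)%N) ?mul0r //.
  by rewrite addnS ltnS ltnW // yka leq_add2r ltnW.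
- by [].
- case: eqP => [-> | _]; last by rewrite mul0r.
  by rewrite addnS ltnS leq_add2r leqNgt kl mulr0.
- by rewrite addrC.
Qed.

(** Letters are cancelled starting with the last one: it sits at the highest
    position at which the right factor is nonzero, so that no entry of that
    factor lies one position further and the superdiagonals add up. *)
Lemma letters_cancel a m :
  \prod_(k < m) letter a (k + a)%N
    * bidiag n (fun y => if (a <= y < m + a)%N then - t a y.+1 else 0) = 1.
Proof.
elim: m => [|m IHm].
  rewrite big_ord0 mul1r bidiag0 // => y _.
  by case: leqP => //= ay; rewrite add0n ltnNge ay.
rewrite big_ord_recr /= -mulrA -[RHS]IHm; congr (_ * _).
apply: bidiag_mul => y.
  case: eqP => [-> | _]; last by rewrite mul0r.
  by rewrite addSn ltnn andbF mulr0.
move=> _; rewrite addSn ltnS (leq_eqVlt y).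
case: eqP => [-> | _] /=; last by rewrite add0r.
by rewrite leq_addl ltnn /= subrr.
Qed.

(** Writing out each column as [U_col_split] does, all letters of first index
    [a] move to the right past the later columns. *)
Lemma U_cols_peel a :
  \prod_(k < n) U_col a k * Uinv_col a = \prod_(k < n) U_col a.+1 k.
Proof.
under eq_bigr do rewrite U_col_split.
rewrite (prod_mul_commute (X := U_col a.+1) (Y := fun k => letter a (k + a)%N));
  last exact: U_col_letter_comm.
have -> : Uinv_col a
    = bidiag n (fun y => if (a <= y < n + a)%N then - t a y.+1 else 0).
  by apply: eq_bidiag => y yn; rewrite (ltn_addr _ yn) andbT.
by rewrite -mulrA letters_cancel mulr1.
Qed.

Lemma U_cols_Uinv_cols m :
  \prod_(k < n) U_col 0 k * \prod_(a < m) Uinv_col a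
    = \prod_(k < n) U_col m k.
Proof.
elim: m => [|m IHm]; first by rewrite big_ord0 mulr1.
by rewrite big_ord_recr mulrA IHm U_cols_peel.
Qed.

Lemma U_col_trivial k : U_col n k = 1.
Proof.
by apply: bidiag0 => y yn; rewrite leqNgt (leq_trans yn) ?leq_addl.
Qed.

End Columns.

(** * The weight matrices *)

(** Non-edges get weight [0], so that the sum over paths becomes a sum over all
    walks. *)
Definition transfer_mx (R : realType) (w : nat -> nat -> nat -> R) n k :
    'M[R]_n.+1 :=
  \matrix_(i, j) (if Uedge k i j then w k i j else 0).

Lemma weight_mxE (R : realType) (w : nat -> nat -> nat -> R) n :
  weight_mx w n = \prod_(k < n) transfer_mx w n k.
Proof.
apply/matrixP=> i j; rewrite mxE -sum_walks.
rewrite (eq_bigl (fun p : {ffun 'I_n.+1 -> 'I_n.+1} =>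
  ((p ord0 == i) && (p ord_max == j)) &&
   [forall k : 'I_n, Uedge k (step_src p k) (step_tgt p k)])); last first.
  by move=> p; rewrite inE andbA.
rewrite big_mkcondr; apply: eq_bigr => p _; rewrite /path_weight.
case: ifPn => [/forallP edges | /forallPn[k /negPf nedge]].
  apply: eq_bigr => k _; rewrite mxE.
  by move: (edges k); rewrite /step_src /step_tgt => ->.
rewrite (bigD1 k) //= mxE.
by move: nedge; rewrite /step_src /step_tgt => ->; rewrite mul0r.
Qed.

Lemma transfer_mx_bidiag (R : realType) (w : nat -> nat -> nat -> R) n k :
    (forall y, w k y y = 1) ->
  transfer_mx w n k = bidiag n (fun y => if (k <= y)%N then w k y y.+1 else 0).
Proof.
move=> w1; apply/matrixP=> i j; rewrite !mxE /Uedge.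
rewrite -(inj_eq val_inj) /= [i == j :> nat]eq_sym.
case: (eqVneq (j : nat) i) => [-> | ji] /=.
  by rewrite (ltn_eqF (ltnSn i)) /= w1 mulr0n addr0.
case: eqP => [-> | _] /=; first by rewrite add0r mulr1n.
by rewrite mulr0n addr0.
Qed.

Lemma U_mxE (R : realType) (t : nat -> nat -> R) n :
  U_mx t n = \prod_(k < n) U_col t n 0 k.
Proof.
rewrite /U_mx weight_mxE; apply: eq_bigr => k _.
rewrite transfer_mx_bidiag => [|y]; last by rewrite /U_weight eqxx.
by apply: eq_bidiag => y _; rewrite /U_weight addn0 (gtn_eqF (ltnSn y)).
Qed.

Lemma Uinv_mxE (R : realType) (t : nat -> nat -> R) n :
  Uinv_mx t n = \prod_(k < n) Uinv_col t n k.
Proof.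
rewrite /Uinv_mx weight_mxE; apply: eq_bigr => k _.
rewrite transfer_mx_bidiag => [|y]; last by rewrite /Uinv_weight eqxx.
by apply: eq_bidiag => y _; rewrite /Uinv_weight (gtn_eqF (ltnSn y)).
Qed.

Theorem theorem4p5 (R : realType) (t : nat -> nat -> R) (n : nat)
    (hn : (1 <= n)%N) :
  U_mx t n *m Uinv_mx t n = 1%:M.
Proof.
rewrite U_mxE Uinv_mxE.
apply: etrans (U_cols_Uinv_cols t n n) _.
by apply: big1 => k _; apply: U_col_trivial.
Qed.
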